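(* Let $(W_t)_{t\ge 0}$ be a standard Wiener process (Brownian motion) and let $\varepsilon>0$. Then, almost surely, the path $t\mapsto W_t$, $t\in[0,1]$, belongs to $A(\varepsilon)$, i.e. $\|W_\cdot\|_{A(\varepsilon)}<\infty$ almost surely, where $$\|f\|_{A(\varepsilon)}:=\sup_{j\in\mathbb{N}_0}\ \sup_{0\le k\le j}\ \sup_{0<t<1}\ \frac{2^{(j-k)/2}}{(j-k+1)^{\varepsilon}}\cdot\frac{(A_kf_j)^*(t)}{\sqrt{\log(1/t)+1}}$$ for $f\in C([0,1])$.
   Context: Let $I=[0,1]$. For $j\in\mathbb{N}_0$ and $m\in\{0,\dots,2^j-1\}$ let $I_{j,m}=[m2^{-j},(m+1)2^{-j}]$ and let $\chi_{j,m}$ be its indicator function. For $f\in C(I)$ define the (Faber) coefficients $$\lambda_{j,m}=\lambda_{j,m}(f)=-2^{j/2-1}\Big(f\big((m+1)2^{-j}\big)-2f\big((2m+1)2^{-j-1}\big)+f\big(m2^{-j}\big)\Big),$$ which are the coefficients of the uniformly convergent expansion $f(x)=f(0)(1-x)+f(1)x+\sum_{j\ge0}\sum_{m=0}^{2^j-1}2^{-j/2}\lambda_{j,m}v_{j,m}(x)$, where $v_{j,m}$ is the hat function supported on $I_{j,m}$, piecewise linear, equal to $0$ at the endpoints of $I_{j,m}$ and $1$ at its midpoint. Put $f_j=\sum_{m=0}^{2^j-1}\lambda_{j,m}\chi_{j,m}$. For integrable $g$ on $I$ and $k\in\mathbb{N}_0$, $(A_kg)(x)=\sum_{l=0}^{2^k-1}2^k\int_{I_{k,l}}g(t)\,dt\cdot\chi_{k,l}(x)$.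 For a measurable $h$ on $I$, $h^*(t)=\inf\{s\ge0: |\{x\in I:|h(x)|>s\}|\le t\}$ denotes the non-increasing rearrangement ($|\cdot|$ is Lebesgue measure). *)

(* Defs.v *)
From HB Require Import structures.
From mathcomp Require Import all_boot all_order all_algebra.
From mathcomp Require Import all_classical all_reals all_analysis.
Set Implicit Arguments. Unset Strict Implicit. Unset Printing Implicit Defensive.
Import Order.TTheory GRing.Theory Num.Theory.
Import numFieldNormedType.Exports.
Local Open Scope classical_set_scope.
Local Open Scope ring_scope.

Section Defs.
Context {R : realType}.

Definition dyI (j m : nat) : set R := `[m%:R * 2 ^- j, m.+1%:R * 2 ^- j].

Definition faber_coef (f : R -> R) (j m : nat) : R :=
  - (2 `^ (j%:R / 2 - 1)) *
    (f (m.+1%:R * 2 ^- j) - 2 * f ((2 * m + 1)%:R * 2 ^- j.+1) + f (m%:R * 2 ^- j)).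

Definition faber_level (f : R -> R) (j : nat) : R -> R :=
  fun x => \sum_(m < 2 ^ j) faber_coef f j m * \1_(dyI j m) x.

Definition avg_op (k : nat) (g : R -> R) : R -> R :=
  fun x => \sum_(l < 2 ^ k)
    (2 ^+ k * (\int[lebesgue_measure]_(t in dyI k l) g t)) * \1_(dyI k l) x.

Definition level_set (h : R -> R) (s : R) : set R :=
  `[0, 1] `&` [set x | s < `|h x|].

Definition decr_rearr (h : R -> R) (t : R) : \bar R :=
  ereal_inf [set s%:E | s in [set s : R | 0 <= s /\
     (lebesgue_measure (level_set h s) <= t%:E)%E]].

Definition A_norm (eps : R) (f : R -> R) : \bar R :=
  ereal_sup [set y | exists j k t, (k <= j)%N /\ 0 < t < 1 /\
     y = (((2 `^ ((j - k)%:R / 2) / (j - k + 1)%:R `^ eps)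
          / Num.sqrt (ln t^-1 + 1))%:E * decr_rearr (avg_op k (faber_level f j)) t)%E].

Definition indep_rvs d (T : measurableType d) (P : probability T R) (n : nat)
  (X : 'I_n -> T -> R) : Prop :=
  forall B : 'I_n -> set R, (forall i, measurable (B i)) ->
    P (\bigcap_(i in [set: 'I_n]) (X i @^-1` B i)) =
    (\prod_(i < n) P (X i @^-1` B i))%E.

Definition standard_wiener d (T : measurableType d) (P : probability T R)
  (W : R -> T -> R) : Prop :=
  [/\ (forall t, 0 <= t -> measurable_fun setT (W t)),
      {ae P, forall w, W 0 w = 0},
      {ae P, forall w, {within `[0, +oo[, continuous (fun t => W t w)}},
      (forall s t, 0 <= s -> s < t -> forall B : set R, measurable B ->
          P ((fun w => W t w - W s w) @^-1` B) = normal_prob 0 (Num.sqrt (t - s)) B) &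
      (forall (n : nat) (t : nat -> R), 0 <= t 0%N ->
          (forall i, (i < n)%N -> t i < t i.+1) ->
          indep_rvs P (fun i : 'I_n => fun w => W (t i.+1) w - W (t i) w))].

End Defs.

(* Main.v *)
(* Put n = j - k.  On I_{k,l} the function A_k f_j is constant, equal to 2^(-n/2) Y_l, where
   Y_l is a signed sum of Brownian increments; the joint exponential moments of (Y_l)_(l < 2^k)
   are those of independent N(0, 1/4) variables, and nothing else about them is used.  Hence the
   empirical exponential moment 2^(-k) sum_l exp(th Y_l) has mean exp(th^2/8) and variance at
   most 2^(-k) exp(th^2/2).  Weighting the squared deviations at th = q and th = -q, q natural,
   by exp(-q^2)/((n+1)(n+2)) makes them summable over (k, n, q), so almost surely there is C
   with 2^(-k) sum_l exp(+-q Y_l) <= C (n+2) exp(q^2/2) for all k, n, q.  By Chebyshev's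
   inequality with q = floor u, the proportion of l with |Y_l| > u is at most a constant times
   (n+2) exp(-u^2/2), which is below t as soon as u is a large multiple of
   (n+1)^eps sqrt(log(1/t) + 1), because log (n+1) <= (n+1)^(2 eps) / (2 eps). *)
Require Import Defs.
From HB Require Import structures.
From mathcomp Require Import all_boot all_order all_algebra.
From mathcomp Require Import all_classical all_reals all_analysis.
From mathcomp Require Import measurable_realfun ring lra zify.
Set Implicit Arguments.
Unset Strict Implicit.
Unset Printing Implicit Defensive.
Import Order.TTheory GRing.Theory Num.Theory.
Import HBNNSimple.
Local Open Scope classical_set_scope.
Local Open Scope ring_scope.

(** * Expectations of products of independent variables *)

Section transfer.
Context {R : realType}.

(** Splitting [h] over its fibres shows that this integral is determined by the integrals of [g]
    against indicators of events of [X]. *)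
Lemma integral_mul_nnsfun d (T : measurableType d) (mu : {measure set T -> \bar R})
    (g X : T -> R) (h : {nnsfun R >-> R}) :
  measurable_fun setT g -> (forall x, 0 <= g x) -> measurable_fun setT X ->
  (\int[mu]_x (g x * h (X x))%:E =
   \sum_(y \in range h) y%:E * \int[mu]_x (g x * \1_(h @^-1` [set y]) (X x))%:E)%E.
Proof.
move=> mg g0 mX.
have mI (A : set R) : measurable A -> measurable_fun setT (fun x => (g x * \1_A (X x))%:E).
  move=> mA; apply/measurable_EFinP/measurable_funM => //.
  by apply: measurableT_comp => //; exact: measurable_indic.
transitivity (\int[mu]_x (\sum_(y \in range h)
    (y * (g x * \1_(h @^-1` [set y]) (X x)))%:E))%E.
  apply: eq_integral => x _; rewrite fsumEFin//; congr EFin.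
  rewrite [in LHS]fimfunE mulr_fsumr//.
  by apply: eq_fsbigr => y _; rewrite mulrCA.
rewrite ge0_integral_fsum//=; last 2 first.
- by move=> y; under eq_fun do rewrite EFinM; apply: measurable_funeM; exact: mI.
- move=> y x _; rewrite lee_fin.
  have [hy|hy] := boolP (h (X x) == y).
    by rewrite mulr_ge0 ?mulr_ge0 // -(eqP hy).
  rewrite indicE memNset ?mulr0//= => /eqP; exact/negP.
apply: eq_fsbigr => y; rewrite inE => -[z _ <-].
under eq_integral do rewrite EFinM.
rewrite ge0_integralZl//; [exact: mI|by move=> x _; rewrite lee_fin mulr_ge0|].
by rewrite lee_fin.
Qed.

(** Two weighted image measures that agree on sets agree on nonnegative functions: simple functions
    first, then monotone convergence along an increasing approximation of [f]. It serves both to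
    exchange a factor in a product of independent variables and to pass from a law to its
    density. *)
Lemma transfer_integral d1 (T1 : measurableType d1) (mu1 : {measure set T1 -> \bar R})
    d2 (T2 : measurableType d2) (mu2 : {measure set T2 -> \bar R})
    (g1 X1 : T1 -> R) (g2 X2 : T2 -> R) (f : R -> R) :
  measurable_fun setT g1 -> (forall x, 0 <= g1 x) -> measurable_fun setT X1 ->
  measurable_fun setT g2 -> (forall x, 0 <= g2 x) -> measurable_fun setT X2 ->
  (forall A, measurable A ->
    \int[mu1]_x (g1 x * \1_A (X1 x))%:E = \int[mu2]_x (g2 x * \1_A (X2 x))%:E)%E ->
  measurable_fun setT f -> (forall x, 0 <= f x) ->
  (\int[mu1]_x (g1 x * f (X1 x))%:E = \int[mu2]_x (g2 x * f (X2 x))%:E)%E.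
Proof.
move=> mg1 g10 mX1 mg2 g20 mX2 eqA mf f0.
have mf' : measurable_fun setT (EFin \o f) by exact/measurable_EFinP.
pose h := nnsfun_approx measurableT mf'.
have approx d (T : measurableType d) (mu : {measure set T -> \bar R}) (g X : T -> R) :
    measurable_fun setT g -> (forall x, 0 <= g x) -> measurable_fun setT X ->
    (\int[mu]_x (g x * h n (X x))%:E)%E @[n --> \oo] -->
    (\int[mu]_x (g x * f (X x))%:E)%E.
  move=> mg g0 mX.
  rewrite [X in _ --> X](_ : _ = \int[mu]_x limn (fun n => (g x * h n (X x))%:E))%E; last first.
    apply: eq_integral => x _; apply/esym/cvg_lim => //.
    under eq_fun do rewrite EFinM.
    rewrite EFinM; apply: cvgeZl => //.
    by apply: cvg_nnsfun_approx => // y _; rewrite lee_fin.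
  apply: cvg_monotone_convergence => //.
  - move=> n; apply/measurable_EFinP/measurable_funM => //.
    exact: measurableT_comp.
  - by move=> n x _; rewrite lee_fin mulr_ge0.
  - move=> x _ m n mn; rewrite lee_fin ler_wpM2l//.
    by have /lefP := nd_nnsfun_approx measurableT mf' mn; exact.
have := approx _ _ mu1 g1 X1 mg1 g10 mX1.
under eq_fun => n.
  rewrite integral_mul_nnsfun//.
  under eq_fsbigr do rewrite eqA//.
  rewrite -integral_mul_nnsfun//.
  over.
move=> h1; have h2 := approx _ _ mu2 g2 X2 mg2 g20 mX2.
exact: (cvg_unique _ h1 h2).
Qed.

Lemma integral_indep_prod d (T : measurableType d) (P : probability T R) n
    (X : 'I_n -> T -> R) (f : 'I_n -> R -> R) (c : 'I_n -> R) :
  indep_rvs P X -> (forall i, measurable_fun setT (X i)) ->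
  (forall i, measurable_fun setT (f i)) -> (forall i x, 0 <= f i x) ->
  (forall i, (\int[P]_w (f i (X i w))%:E = (c i)%:E)%E) ->
  (\int[P]_w (\prod_i f i (X i w))%:E = (\prod_i c i)%:E)%E.
Proof.
move=> iX mX.
(* The factors are turned one at a time from indicators into general functions. *)
suff H r : (r <= n)%N -> forall (f : 'I_n -> R -> R) (c : 'I_n -> R),
    (forall i, measurable_fun setT (f i)) ->
    (forall i x, 0 <= f i x) ->
    (forall i, (\int[P]_w (f i (X i w))%:E = (c i)%:E)%E) ->
    (forall i : 'I_n, (r <= i)%N -> exists2 A, measurable A & f i = \1_A) ->
    (\int[P]_w (\prod_i f i (X i w))%:E = (\prod_i c i)%:E)%E.
  move=> mf f0 fc; apply: (H n) => // i; by rewrite leqNgt ltn_ord.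
elim: r => [_|r IH rn] {}f {}c mf f0 fc fI.
  have /choice[A AP] i : exists A, measurable A /\ f i = \1_A.
    by have [A mA fA] := fI i isT; exists A.
  transitivity (P (\bigcap_(i in [set: 'I_n]) (X i @^-1` A i))).
    rewrite -[in RHS](setIT (\bigcap_(i in _) _)) -integral_indic//; last first.
      apply: fin_bigcap_measurable => // i _; rewrite -[_ @^-1` _]setTI.
      by apply: mX => //; case: (AP i).
    apply: eq_integral => w _; congr EFin; rewrite indicE.
    have [wA|/negP wA] := boolP (w \in _).
      rewrite big1// => i _; rewrite (AP i).2 indicE mem_set//.
      by move: wA; rewrite inE; exact.
    have [i wi] : exists i, ~ (A i (X i w)).
      apply/existsNP => h; apply: wA; rewrite inE => i _; exact: h.
    by apply/eqP/prodf_eq0; exists i => //; rewrite (AP i).2 indicE memNset.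
  rewrite iX; last by move=> i; case: (AP i).
  rewrite -prodEFin; apply: eq_bigr => i _.
  rewrite -fc (AP i).2 -[in LHS](setIT (X i @^-1` A i)) -integral_indic//.
  by rewrite -[_ @^-1` _]setTI; apply: mX => //; case: (AP i).
pose i0 : 'I_n := Ordinal rn.
have mprod (F : 'I_n -> R -> R) : (forall i, measurable_fun setT (F i)) ->
    measurable_fun setT (fun w => \prod_(i | i != i0) F i (X i w)).
  move=> mF; under eq_fun do rewrite -big_filter.
  by apply: measurable_prod => i _; exact: measurableT_comp.
have c0 i : 0 <= c i.
  by rewrite -lee_fin -fc; apply: integral_ge0 => w _; rewrite lee_fin.
under eq_integral do rewrite (bigD1 i0)//= mulrC.
(* The product of the other factors acts as a weight, to be traded for its constant expected value.
   This is allowed once both weights agree on events of [X i0]; with an indicator in position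
   [i0 = r] that is the induction hypothesis, applied to [f'] and [c']. *)
rewrite (@transfer_integral _ _ P _ _ P _ _ (cst (\prod_(i | i != i0) c i)) (X i0))//.
- under eq_integral do rewrite /= EFinM.
  rewrite ge0_integralZl//.
  + by rewrite fc -EFinM [in RHS](bigD1 i0)//= mulrC.
  + apply/measurable_EFinP; exact: measurableT_comp.
  + by move=> w _; rewrite lee_fin.
  + by rewrite lee_fin prodr_ge0.
- exact: mprod.
- by move=> w; rewrite prodr_ge0.
- by move=> w /=; rewrite prodr_ge0.
move=> A mA.
have mXA : measurable (X i0 @^-1` A) by rewrite -[_ @^-1` _]setTI; exact: mX.
pose f' i := if i == i0 then \1_A : R -> R else f i.
pose c' i := if i == i0 then fine (P (X i0 @^-1` A)) else c i.
have PA : (\int[P]_w (\1_A (X i0 w))%:E = (fine (P (X i0 @^-1` A)))%:E)%E.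
  rewrite fineK ?fin_num_measure// -[in RHS](setIT (_ @^-1` _)) -integral_indic//.
have H : (\int[P]_w (\prod_i f' i (X i w))%:E = (\prod_i c' i)%:E)%E.
  apply: IH => [|i|i x|i|i ri]; first exact: ltnW.
  - by rewrite /f'; case: eqP => // _; exact: measurable_indic.
  - by rewrite /f'; case: eqP.
  - by rewrite /f' /c'; case: eqP => [->|].
  - rewrite /f'; case: eqP => [_|/eqP ii0]; first by exists A.
    apply: fI; rewrite ltn_neqAle ri andbT; apply: contra ii0 => /eqP ri'.
    by apply/eqP/val_inj.
transitivity (\prod_i c' i)%:E.
  rewrite -H; apply: eq_integral => w _; congr EFin.
  rewrite [RHS](bigD1 i0)//= {1}/f' eqxx mulrC; congr (_ * _).
  by apply: eq_bigr => i /negbTE ii0; rewrite /f' ii0.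
under [RHS]eq_integral do rewrite /= EFinM.
rewrite ge0_integralZl//.
- rewrite PA -EFinM (bigD1 i0)//= {1}/c' eqxx mulrC; congr (_ * _)%:E.
  by apply: eq_bigr => i /negbTE ii0; rewrite /c' ii0.
- by apply/measurable_EFinP; apply: measurableT_comp => //; exact: measurable_indic.
- by rewrite lee_fin prodr_ge0.
Qed.

(** Completing the square: [expR (th * x)] times the centred density is a constant times the normal
    density with mean [th * s ^+ 2], whose integral is 1. *)
Lemma normal_mgf d (T : measurableType d) (P : probability T R) (X : T -> R) (s th : R) :
  0 < s -> measurable_fun setT X ->
  (forall B, measurable B -> P (X @^-1` B) = normal_prob 0 s B) ->
  (\int[P]_w (expR (th * X w))%:E = (expR (th ^+ 2 * s ^+ 2 / 2))%:E)%E.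
Proof.
move=> s0 mX PX.
under eq_integral do rewrite -[expR _]mul1r.
rewrite (@transfer_integral _ _ P _ (measurableTypeR R) lebesgue_measure (cst 1) X
  (normal_pdf 0 s) id (fun x => expR (th * x)))//; first last.
- apply: measurableT_comp => //; exact: measurable_funM.
- move=> A mA; under eq_integral do rewrite mul1r.
  transitivity (P (X @^-1` A)).
    rewrite -[in RHS](setIT (_ @^-1` _)) -integral_indic//.
    by rewrite -[_ @^-1` _]setTI; exact: mX.
  rewrite PX// /normal_prob [LHS]integral_mkcond; apply: eq_integral => x _.
  by rewrite patchE indicE; case: (x \in A); rewrite ?mulr1 ?mulr0.
- by move=> x; exact: normal_pdf_ge0.
- exact: measurable_normal_pdf.
transitivity (\int[lebesgue_measure]_x
    ((expR (th ^+ 2 * s ^+ 2 / 2))%:E * (normal_pdf (th * s ^+ 2) s x)%:E))%E.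
  apply: eq_integral => x _; rewrite -EFinM; congr EFin.
  rewrite !normal_pdfE ?gt_eqF// /normal_fun -!mulrA -expRD mulrCA -expRD.
  congr (_ * expR _); field; by rewrite gt_eqF.
rewrite ge0_integralZl//.
- by rewrite integral_normal_pdf mule1.
- by apply/measurable_EFinP; exact: measurable_normal_pdf.
- by move=> x _; rewrite lee_fin normal_pdf_ge0.
Qed.

Lemma indep_normal_mgf d (T : measurableType d) (P : probability T R) n
    (X : 'I_n -> T -> R) (s : R) (th : 'I_n -> R) :
  0 < s -> indep_rvs P X -> (forall i, measurable_fun setT (X i)) ->
  (forall i B, measurable B -> P (X i @^-1` B) = normal_prob 0 s B) ->
  (\int[P]_w (expR (\sum_i th i * X i w))%:E =
   (expR (\sum_i th i ^+ 2 * s ^+ 2 / 2))%:E)%E.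
Proof.
move=> s0 iX mX PX.
under eq_integral do rewrite expR_sum.
rewrite expR_sum (integral_indep_prod (f := fun i x => expR (th i * x))
  (c := fun i => expR (th i ^+ 2 * s ^+ 2 / 2)) iX)//.
- by move=> i; apply: measurableT_comp => //; exact: measurable_funM.
- by move=> i; apply: normal_mgf => // B mB; exact: PX.
Qed.

End transfer.

(** * Exponential moments of the block averages *)

Section blocks.
Context {R : realType}.

(** The value that averaging over the [l]-th interval of level [k] produces from level [k + n], as
    [dyadic_mean_faber_level] confirms. *)
Definition block_avg (f : R -> R) (k n l : nat) : R :=
  2 ^- n * \sum_(i < 2 ^ n) faber_coef f (k + n) (l * 2 ^ n + i).

(** The variable called Y_l in the overview; for a Brownian path this scaling gives it variance 1/4
    for every [k] and [n]. *)
Definition normalized_block (f : R -> R) (k n l : nat) : R :=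
  2 `^ (n%:R / 2) * block_avg f k n l.

Definition dyadic_incr (f : R -> R) (j i : nat) : R :=
  f (i.+1%:R * 2 ^- j) - f (i%:R * 2 ^- j).

Lemma alternating_sum (X : nat -> R) m :
  \sum_(i < m.*2) (-1) ^+ i * X i = \sum_(i < m) (X i.*2 - X i.*2.+1).
Proof.
elim: m => [|m IH]; first by rewrite !big_ord0.
rewrite doubleS !big_ord_recr/= IH -addrA; congr (_ + _).
by rewrite exprS -signr_odd odd_double expr0; ring.
Qed.

(** Euclidean division flattens a double sum. It turns blocks of increments into one independent
    family, and groups fine dyadic intervals by their ancestors. *)
Lemma sum_divn_modn p q (F : nat -> nat -> R) : (0 < q)%N ->
  \sum_(i < p * q) F (i %/ q)%N (i %% q)%N = \sum_(l < p) \sum_(i < q) F l i.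
Proof.
move=> q0.
rewrite -[LHS](big_mkord xpredT (fun i => F (i %/ q)%N (i %% q)%N)) big_nat_mul big_mkord.
apply: eq_bigr => l _.
rewrite -[(l * q)%N]add0n mulSn big_addn addnK big_mkord.
apply: eq_bigr => i _.
by rewrite [(i + _)%N]addnC divnMDl// divn_small// addn0 modnMDl modn_small.
Qed.

(** A second difference is a difference of two neighbouring increments at half the mesh; the minus
    sign of the coefficient puts the left one first. *)
Lemma faber_coef_incr (f : R -> R) j m :
  faber_coef f j m =
  2 `^ (j%:R / 2 - 1) * (dyadic_incr f j.+1 m.*2 - dyadic_incr f j.+1 m.*2.+1).
Proof.
have half i : i.*2%:R * 2 ^- j.+1 = i%:R * 2 ^- j :> R.
  by rewrite -muln2 natrM exprS; field; rewrite expf_neq0.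
rewrite /faber_coef /dyadic_incr -[in LHS](half m.+1) -[in LHS](half m).
rewrite (_ : (2 * m + 1 = m.*2.+1)%N); last by lia.
by rewrite doubleS; ring.
Qed.

Lemma normalized_blockE (f : R -> R) k n l :
  normalized_block f k n l = \sum_(i < 2 ^ n.+1)
    2 `^ (k%:R / 2 - 1) * (-1) ^+ i * dyadic_incr f (k + n).+1 (l * 2 ^ n.+1 + i).
Proof.
under eq_bigr do rewrite -mulrA.
rewrite -mulr_sumr expnS mul2n
  (alternating_sum (fun i => dyadic_incr f (k + n).+1 (l * (2 ^ n).*2 + i))).
rewrite /normalized_block /block_avg mulrA.
under eq_bigr do rewrite faber_coef_incr.
rewrite -mulr_sumr mulrA; congr (_ * _); last first.
  apply: eq_bigr => i _; rewrite -doubleMr.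
  by congr (_ - _); congr dyadic_incr; lia.
(* The exponents [n / 2], [- n] and [(k + n) / 2 - 1] add up to [k / 2 - 1], so [n] disappears from
   the factor. *)
rewrite -powR_mulrn// -powRN -!powRD ?pnatr_eq0 ?implybT//.
by congr powR; rewrite natrD; field.
Qed.

Lemma measurable_normalized_block d (T : measurableType d) (W : R -> T -> R) k n l :
  (forall t, 0 <= t -> measurable_fun setT (W t)) ->
  measurable_fun setT (fun w => normalized_block (W ^~ w) k n l).
Proof.
move=> mW; under eq_fun do rewrite normalized_blockE.
apply: measurable_sum => i; apply: measurable_funM => //.
by apply: measurable_funB; apply: mW; rewrite mulr_ge0// invr_ge0 exprn_ge0.
Qed.

(** Different blocks use disjoint groups of increments, so a combination of blocks is one linear
    form in independent normal variables of equal variance. *)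
Lemma normalized_block_mgf d (T : measurableType d) (P : probability T R)
    (W : R -> T -> R) k n (th : nat -> R) :
  standard_wiener P W ->
  (\int[P]_w (expR (\sum_(l < 2 ^ k) th l * normalized_block (W ^~ w) k n l))%:E =
   (expR (\sum_(l < 2 ^ k) th l ^+ 2 / 8))%:E)%E.
Proof.
move=> [mW _ _ normW indepW].
pose q := (2 ^ n.+1)%N; have q0 : (0 < q)%N by rewrite expn_gt0.
pose t (i : nat) : R := i%:R * 2 ^- (k + n).+1.
have t0 i : 0 <= t i by rewrite mulr_ge0// invr_ge0 exprn_ge0.
have tS i : t i.+1 - t i = 2 ^- (k + n).+1 by rewrite /t -mulrBl -natrB// subSnn mul1r.
have tlt i : t i < t i.+1 by rewrite -subr_gt0 tS invr_gt0 exprn_gt0.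
pose s : R := Num.sqrt (2 ^- (k + n).+1).
have s0 : 0 < s by rewrite sqrtr_gt0 invr_gt0 exprn_gt0.
pose c : R := 2 `^ (k%:R / 2 - 1).
(* The coefficient of the [i]-th increment: the quotient of [i] by [q] names its block, the
   remainder its sign. *)
pose a i := th (i %/ q)%N * (c * (-1) ^+ (i %% q)%N).
have indepX N := indepW N t (t0 0%N) (fun i _ => tlt i).
have mX i : measurable_fun setT (fun w => W (t i.+1) w - W (t i) w).
  by apply: measurable_funB; apply: mW; exact: t0.
have normX i B : measurable B ->
    P ((fun w => W (t i.+1) w - W (t i) w) @^-1` B) = normal_prob 0 s B.
  by move=> mB; rewrite normW ?tS; [|exact: t0|exact: tlt|].
transitivity (\int[P]_w (expR (\sum_(i < 2 ^ k * q) a i *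
    (W (t i.+1) w - W (t i) w)))%:E)%E.
  apply: eq_integral => w _; congr (expR _)%:E.
  under eq_bigr do rewrite normalized_blockE mulr_sumr.
  rewrite -(sum_divn_modn _ (fun l i => th l * (c * (-1) ^+ i *
    dyadic_incr (W ^~ w) (k + n).+1 (l * q + i))))//.
  by apply: eq_bigr => i _; rewrite -divn_eq /a -!mulrA.
rewrite (indep_normal_mgf (fun i => a i) s0 (indepX _) (fun i => mX i) (fun i => normX i)).
congr (expR _)%:E.
rewrite (sum_divn_modn _ (fun l i => (th l * (c * (-1) ^+ i)) ^+ 2 * s ^+ 2 / 2) q0).
apply: eq_bigr => l _.
(* The [2 ^ n.+1] equal terms of a block, each with [c ^+ 2 = 2 ^+ k / 4] and
   [s ^+ 2 = 2 ^- (k + n).+1], add up to [th l ^+ 2 / 8]. *)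
under eq_bigr do rewrite !exprMn sqrr_sign mulr1.
rewrite sumr_const card_ord /s sqr_sqrtr ?invr_ge0 ?exprn_ge0//.
have -> : c ^+ 2 = 2 ^+ k / 4.
  rewrite /c -powR_mulrn ?powR_ge0// -powRrM mulrBl mul1r divfK//.
  have e4 : 2 `^ 2%:R = 4 :> R by rewrite powR_mulrn//; ring.
  by rewrite powRB ?pnatr_eq0 ?implybT// e4 powR_mulrn.
rewrite -[LHS]mulr_natr /q natrX -addnS exprD.
set Q := 2 ^+ n.+1; set K := 2 ^+ k.
have Q0 : Q != 0 :> R by rewrite expf_neq0.
have K0 : K != 0 :> R by rewrite expf_neq0.
by clearbody Q K; field; rewrite Q0 K0.
Qed.
End blocks.

(** * Second moments of the empirical exponential moments *)

Section second_moment.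
Context {R : realType} d (T : measurableType d).

Lemma integral_sum_ord (mu : {measure set T -> \bar R}) N (F : nat -> T -> R) :
  (forall i, measurable_fun setT (F i)) -> (forall i w, 0 <= F i w) ->
  (\int[mu]_w (\sum_(i < N) F i w)%:E = \sum_(i < N) \int[mu]_w (F i w)%:E)%E.
Proof.
move=> mF F0; under eq_integral do rewrite -sumEFin.
rewrite (ge0_integral_sum _ _ (f := fun (i : 'I_N) w => (F i w)%:E))// => i.
- exact/measurable_EFinP.
- by move=> w _; rewrite lee_fin.
Qed.

(** Only pairwise products enter: the square of the sum has mean [N v + N (N - 1) m^2], which leaves
    exactly [(v - m^2) / N] for the centred average. *)
Lemma second_moment_avg (P : probability T R) N (E : nat -> T -> R) (m v : R) :
  (0 < N)%N -> (forall l, measurable_fun setT (E l)) -> (forall l w, 0 <= E l w) ->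
  (forall l : 'I_N, (\int[P]_w (E l w)%:E = m%:E)%E) ->
  (forall l l' : 'I_N, (\int[P]_w (E l w * E l' w)%:E =
    (if l == l' then v else m ^+ 2)%:E)%E) ->
  (\int[P]_w ((N%:R^-1 * (\sum_(l < N) E l w) - m) ^+ 2)%:E <= (N%:R^-1 * v)%:E)%E.
Proof.
move=> N0 mE E0 Em Ev.
have N0' : N%:R != 0 :> R by rewrite pnatr_eq0 -lt0n.
have m0 : 0 <= m.
  by rewrite -lee_fin -(Em (Ordinal N0)); apply: integral_ge0 => w _; rewrite lee_fin.
pose S w := \sum_(l < N) E l w.
have mS : measurable_fun setT S by exact: measurable_sum.
have S0 w : 0 <= S w by exact: sumr_ge0.
have IS : (\int[P]_w (S w)%:E = (N%:R * m)%:E)%E.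
  rewrite integral_sum_ord//; under eq_bigr do rewrite Em.
  by rewrite sumEFin sumr_const card_ord mulr_natl.
have IS2 : (\int[P]_w (S w ^+ 2)%:E =
    (N%:R * v + (N%:R ^+ 2 - N%:R) * m ^+ 2)%:E)%E.
  under eq_integral do rewrite expr2 {1}/S mulr_suml.
  rewrite (integral_sum_ord _ _ (F := fun l w => E l w * S w)); last 2 first.
  - by move=> l; exact: measurable_funM.
  - by move=> l w; rewrite mulr_ge0.
  transitivity (\sum_(l < N) (v + (N%:R - 1) * m ^+ 2)%:E)%E.
    apply: eq_bigr => l _.
    under eq_integral do rewrite /S mulr_sumr.
    rewrite (integral_sum_ord _ _ (F := fun l' w => E l w * E l' w)); last 2 first.
    - by move=> l'; exact: measurable_funM.
    - by move=> l' w; rewrite mulr_ge0.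
    under eq_bigr do rewrite Ev.
    rewrite sumEFin (bigD1 l)//= eqxx; congr (_ + _)%:E.
    transitivity (\sum_(l' < N | l' != l) m ^+ 2).
      by apply: eq_bigr => l' /negbTE; rewrite eq_sym => ->.
    rewrite sumr_const cardC1 card_ord -[LHS]mulr_natl.
    by rewrite -subn1 natrB.
  by rewrite sumEFin sumr_const card_ord -[X in X%:E = _]mulr_natl; congr EFin; ring.
pose D w := (N%:R^-1 * S w - m) ^+ 2.
have mD : measurable_fun setT D.
  by apply: measurable_funX; apply: measurable_funB => //; exact: measurable_funM.
(* The cross term of the square is moved to the left, so that every integrand is nonnegative and
   additivity needs no integrability; the finite constant is subtracted afterwards. *)
have ID : (\int[P]_w (D w)%:E + (2 * m ^+ 2)%:E =
    (N%:R^-1 * (v - m ^+ 2) + 2 * m ^+ 2)%:E)%E.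
  transitivity (\int[P]_w (D w)%:E + \int[P]_w (2 * m / N%:R * S w)%:E)%E.
    congr (_ + _)%E; under eq_integral do rewrite EFinM.
    rewrite ge0_integralZl//.
    - by rewrite IS -EFinM; congr EFin; field.
    - exact/measurable_EFinP.
    - by move=> w _; rewrite lee_fin.
    - by rewrite lee_fin divr_ge0// mulr_ge0.
  rewrite -ge0_integralD//.
  - transitivity (\int[P]_w ((N%:R ^- 2)%:E * (S w ^+ 2)%:E + cst (m ^+ 2)%:E w))%E.
      by apply: eq_integral => w _; rewrite -EFinM -!EFinD /D /=; congr EFin; field.
    rewrite ge0_integralD//.
    + rewrite ge0_integralZl//.
      * rewrite IS2 integral_cst//= probability_setT mule1 -EFinM -EFinD.
        by congr EFin; field.
      * by apply/measurable_EFinP; exact: measurable_funX.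
      * by move=> w _; rewrite lee_fin sqr_ge0.
    + by move=> w _; rewrite -EFinM lee_fin mulr_ge0 ?sqr_ge0 ?invr_ge0 ?exprn_ge0.
    + apply/measurable_EFinP; apply: measurable_funM => //; exact: measurable_funX.
    + by move=> w _; rewrite lee_fin sqr_ge0.
  - by move=> w _; rewrite lee_fin sqr_ge0.
  - exact/measurable_EFinP.
  - by move=> w _; rewrite lee_fin mulr_ge0// divr_ge0// mulr_ge0.
  - by apply/measurable_EFinP; exact: measurable_funM.
have -> : (\int[P]_w (D w)%:E = (N%:R^-1 * (v - m ^+ 2))%:E)%E.
  have := congr1 (fun x => x - (2 * m ^+ 2)%:E)%E ID.
  by rewrite addeK// => ->; rewrite -EFinB; congr EFin; ring.
rewrite lee_fin ler_wpM2l ?invr_ge0//.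
by rewrite gerBl sqr_ge0.
Qed.

(** By monotone convergence the pointwise limit has integral at most [c], so it is finite almost
    everywhere and bounds the sequence. *)
Lemma nondecreasing_ae_bounded (P : probability T R) (G : nat -> T -> R) (c : R) :
  (forall N, measurable_fun setT (G N)) -> (forall N w, 0 <= G N w) ->
  (forall w, nondecreasing_seq (G ^~ w)) ->
  (forall N, \int[P]_w (G N w)%:E <= c%:E)%E ->
  {ae P, forall w, exists C, forall N, G N w <= C}.
Proof.
move=> mG G0 ndG Gc.
have ndE w : nondecreasing_seq (fun N => (G N w)%:E).
  by move=> a b ab; rewrite lee_fin; exact: ndG.
pose f w := limn (fun N => (G N w)%:E).
have cvgf w : (G N w)%:E @[N --> \oo] --> f w.
  exact: ereal_nondecreasing_is_cvgn.
have le_f w N : ((G N w)%:E <= f w)%E.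
  have -> : f w = ereal_sup (range (fun N => (G N w)%:E)).
    exact/cvg_lim/ereal_nondecreasing_cvgn.
  by apply: ereal_sup_ubound; exists N.
have f0 w : (0 <= f w)%E by apply: le_trans (le_f w 0%N); rewrite lee_fin.
have mGE N : measurable_fun setT (fun w => (G N w)%:E) by exact/measurable_EFinP.
have mf : measurable_fun setT f.
  apply: (emeasurable_fun_cvg (fun N w => (G N w)%:E)) => // w _; exact: cvgf.
have If : (\int[P]_w f w <= c%:E)%E.
  have := cvg_monotone_convergence measurableT mGE
    (fun N w _ => G0 N w : (0 <= (G N w)%:E)%E) (fun w _ => @ndE w) => /(_ P) cvgI.
  rewrite -(cvg_lim _ cvgI)//; apply: lime_le; first by apply/cvg_ex; eexists; exact: cvgI.
  by apply: nearW => N; exact: Gc.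
have : P.-integrable setT f.
  apply/integrableP; split => //.
  under eq_integral do rewrite gee0_abs//.
  by apply: le_lt_trans If _; rewrite ltry.
move=> /(integrable_ae measurableT); apply: filterS => w /(_ I) fw.
by exists (fine (f w)) => N; rewrite -lee_fin fineK.
Qed.
End second_moment.

(** * Empirical exponential moments of the blocks and their deviations from the mean *)

Section empirical.
Context {R : realType}.

Definition empirical_mgf (f : R -> R) (k n : nat) (th : R) : R :=
  (2 ^ k)%:R^-1 * \sum_(l < 2 ^ k) expR (th * normalized_block f k n l).

Definition deviation (f : R -> R) (k n : nat) (th : R) : R :=
  empirical_mgf f k n th - expR (th ^+ 2 / 8).

Context d (T : measurableType d) (P : probability T R) (W : R -> T -> R)
  (wienerW : standard_wiener P W).

Lemma measurable_deviation k n th :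
  measurable_fun setT (fun w => deviation (W ^~ w) k n th).
Proof.
case: wienerW => mW _ _ _ _.
apply: measurable_funB => //; apply: measurable_funM => //.
apply: measurable_sum => l; apply: measurableT_comp => //.
by apply: measurable_funM => //; exact: measurable_normalized_block.
Qed.

(** A Kronecker delta in the parameters of the joint exponential moment singles out one block; a sum
    of two deltas gives a pair. *)
Let delta_sum N (a : 'I_N) (F : nat -> R) : \sum_(l < N) (nat_of_ord l == a)%:R * F l = F a.
Proof.
rewrite (bigD1 a)//= eqxx mul1r big1 ?addr0// => l la.
by rewrite (_ : nat_of_ord l == a = false) ?mul0r//; exact: negbTE.
Qed.

(** Off the diagonal the mean of the product is the squared mean [expR (th ^+ 2 / 4)]; on it the
    parameter doubles to [2 * th], which gives [v = expR (th ^+ 2 / 2)]. *)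
Lemma deviation_second_moment k n th :
  (\int[P]_w (deviation (W ^~ w) k n th ^+ 2)%:E <=
   ((2 ^ k)%:R^-1 * expR (th ^+ 2 / 2))%:E)%E.
Proof.
have [mW _ _ _ _] := wienerW.
apply: (@second_moment_avg _ _ _ P (2 ^ k)
  (fun l w => expR (th * normalized_block (W ^~ w) k n l))) => //.
- by rewrite expn_gt0.
- move=> l; apply: measurableT_comp => //.
  by apply: measurable_funM => //; exact: measurable_normalized_block.
- move=> a.
  have := normalized_block_mgf k n (fun l => (l == a)%:R * th) wienerW.
  rewrite (eq_integral (fun w => (expR (th * normalized_block (W ^~ w) k n a))%:E)); last first.
    move=> w _; congr (expR _)%:E; under eq_bigr do rewrite -mulrA.
    exact: (delta_sum a (fun l => th * normalized_block (W ^~ w) k n l)).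
  move=> ->; congr EFin; congr expR.
  rewrite -[RHS](delta_sum a (fun=> th ^+ 2 / 8)); apply: eq_bigr => l _.
  by case: (nat_of_ord l == a); rewrite /= ?mulr0n ?mulr1n; field.
- move=> a b; under eq_integral do rewrite -expRD -mulrDr.
  transitivity (\int[P]_w (expR (\sum_(l < 2 ^ k)
      ((nat_of_ord l == a)%:R + (nat_of_ord l == b)%:R) * th *
        normalized_block (W ^~ w) k n l))%:E)%E.
    apply: eq_integral => w _; congr EFin; congr expR.
    under [RHS]eq_bigr do rewrite -mulrA mulrDl.
    rewrite big_split/= mulrDr; congr (_ + _); apply/esym.
      exact: (delta_sum a (fun l => th * normalized_block (W ^~ w) k n l)).
    exact: (delta_sum b (fun l => th * normalized_block (W ^~ w) k n l)).
  rewrite (normalized_block_mgf k n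
    (fun l => ((l == a)%:R + (l == b)%:R) * th) wienerW); congr EFin.
  transitivity (expR (th ^+ 2 / 8 * (2 + 2 * (a == b)%:R))).
    congr expR.
    (* The square of a sum of two deltas is their sum plus twice their product. *)
    transitivity (\sum_(l < 2 ^ k) ((nat_of_ord l == a)%:R * (th ^+ 2 / 8) +
      (nat_of_ord l == b)%:R * (th ^+ 2 / 8) +
      (nat_of_ord l == a)%:R * ((l == b :> nat)%:R * (th ^+ 2 / 4)))).
      apply: eq_bigr => l _.
      by case: (nat_of_ord l == a); case: (nat_of_ord l == b); rewrite /= ?mulr0n ?mulr1n; field.
    rewrite !big_split/= (delta_sum a (fun=> th ^+ 2 / 8))
      (delta_sum b (fun=> th ^+ 2 / 8))
      (delta_sum a (fun l => (l == b)%:R * (th ^+ 2 / 4))).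
    have -> : (nat_of_ord a == b) = (a == b) by [].
    by case: (a == b); rewrite /= ?mulr0n ?mulr1n; field.
  by case: (a == b); rewrite /= ?mulr0n ?mulr1n -?expRM_natl; congr expR; field.
Qed.
End empirical.

(** * The almost sure bound *)

Section almost_sure.
Context {R : realType}.

Lemma ler_sum_ord (a b : nat -> R) (M N : nat) : (M <= N)%N ->
  (forall i, a i <= b i) -> (forall i, 0 <= b i) ->
  \sum_(i < M) a i <= \sum_(i < N) b i.
Proof.
move=> MN ab b0; apply: le_trans (_ : \sum_(i < M) b i <= _); first exact: ler_sum.
by rewrite -!(big_mkord xpredT b) (big_cat_nat _ MN)//= lerDl sumr_ge0.
Qed.

Lemma term_le_sum_ord (a : nat -> R) (i N : nat) : (i < N)%N ->
  (forall i, 0 <= a i) -> a i <= \sum_(i < N) a i.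
Proof. by move=> iN a0; rewrite (bigD1 (Ordinal iN))//= lerDl sumr_ge0. Qed.

Lemma sum_pow2_le (N : nat) : \sum_(i < N) (2 ^ i)%:R^-1 <= 2 :> R.
Proof.
suff -> : \sum_(i < N) (2 ^ i)%:R^-1 = 2 - 2 * 2 ^- N :> R.
  by rewrite gerBl mulr_ge0// invr_ge0 exprn_ge0.
elim: N => [|N IH]; first by rewrite big_ord0 expr0 invr1 mulr1 subrr.
by rewrite big_ord_recr/= IH natrX exprS; field; rewrite expf_neq0.
Qed.

Lemma sum_inv_rising_le (N : nat) : \sum_(n < N) (n.+1%:R * n.+2%:R)^-1 <= 1 :> R.
Proof.
suff -> : \sum_(n < N) (n.+1%:R * n.+2%:R)^-1 = 1 - N.+1%:R^-1 :> R.
  by rewrite gerBl invr_ge0.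
elim: N => [|N IH]; first by rewrite big_ord0 invr1 subrr.
rewrite big_ord_recr/= IH -[N.+2%:R]natr1 -[N.+1%:R]natr1; field.
by rewrite -[1]/(1%:R) -!natrD !pnatr_eq0 !addn_eq0 !andbF.
Qed.

(** From [(q - 1)^2 >= 0] the exponent is at most [1 / 2 - q], and [expR 1 >= 2]; the Gaussian
    weight is thereby dominated by a geometric series. *)
Lemma expR_Nsqr_half_le (q : nat) :
  expR (- (q%:R ^+ 2 / 2)) <= expR (1 / 2) * (2 ^ q)%:R^-1 :> R.
Proof.
apply: le_trans (_ : expR (1 / 2 - q%:R) <= _).
  rewrite ler_expR -subr_ge0 (_ : _ - _ = (q%:R - 1) ^+ 2 / 2); last by field.
  by rewrite divr_ge0 ?sqr_ge0.
rewrite expRD ler_pM2l ?expR_gt0// expRN natrX lef_pV2 ?posrE ?expR_gt0 ?exprn_gt0//.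
rewrite -[q%:R]mulr1 expRM_natl lerXn2r ?nnegrE ?expR_ge0//.
by have := expR_ge1Dx (1 : R).
Qed.

Context d (T : measurableType d) (P : probability T R) (W : R -> T -> R)
  (wienerW : standard_wiener P W).

(** Against a second moment of order [expR (q^2 / 2)] the Gaussian weight leaves [expR (- q^2 / 2)],
    and the rational weight makes the sum over [n] telescope. The sum over [k] converges through the
    factor [2^-k] of the second moment itself. *)
Definition weighted_deviation (f : R -> R) (k n q : nat) : R :=
  (n.+1%:R * n.+2%:R)^-1 * expR (- q%:R ^+ 2) *
    (deviation f k n q%:R ^+ 2 + deviation f k n (- q%:R) ^+ 2).

Lemma weighted_deviation_ge0 f k n q : 0 <= weighted_deviation f k n q.
Proof.
by rewrite mulr_ge0 ?addr_ge0 ?sqr_ge0// mulr_ge0 ?expR_ge0// invr_ge0 mulr_ge0.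
Qed.

Lemma measurable_weighted_deviation k n q :
  measurable_fun setT (fun w => weighted_deviation (W ^~ w) k n q).
Proof.
apply: measurable_funM => //.
by apply: measurable_funD; apply: measurable_funX; exact: (measurable_deviation wienerW).
Qed.

Lemma integral_weighted_deviation k n q :
  (\int[P]_w (weighted_deviation (W ^~ w) k n q)%:E <=
   (2 * expR (1 / 2) * (2 ^ k)%:R^-1 * (n.+1%:R * n.+2%:R)^-1 * (2 ^ q)%:R^-1)%:E)%E.
Proof.
have mdev th : measurable_fun setT (fun w => (deviation (W ^~ w) k n th ^+ 2)%:E).
  by apply/measurable_EFinP/measurable_funX/(measurable_deviation wienerW).
have c0 : 0 <= (n.+1%:R * n.+2%:R)^-1 * expR (- q%:R ^+ 2) :> R.
  by rewrite mulr_ge0 ?expR_ge0// invr_ge0 mulr_ge0.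
under eq_integral do rewrite /weighted_deviation EFinM EFinD.
rewrite ge0_integralZl//; last 2 first.
- exact: emeasurable_funD.
- by move=> w _; rewrite -EFinD lee_fin addr_ge0 ?sqr_ge0.
rewrite ge0_integralD//; last 2 first.
- by move=> w _; rewrite lee_fin sqr_ge0.
- by move=> w _; rewrite lee_fin sqr_ge0.
have D2 th : th ^+ 2 = q%:R ^+ 2 -> (\int[P]_w (deviation (W ^~ w) k n th ^+ 2)%:E <=
    ((2 ^ k)%:R^-1 * expR (q%:R ^+ 2 / 2))%:E)%E.
  by move=> <-; exact: deviation_second_moment.
apply: le_trans (lee_wpmul2l _ (leeD (D2 _ erefl) (D2 _ (sqrrN _)))) _.
  by rewrite lee_fin.
rewrite -EFinD -EFinM lee_fin.
rewrite [leLHS](_ : _ = 2 * (2 ^ k)%:R^-1 * (n.+1%:R * n.+2%:R)^-1 *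
    expR (- (q%:R ^+ 2 / 2))); last first.
  rewrite [- (_ / 2)](_ : _ = - q%:R ^+ 2 + q%:R ^+ 2 / 2); last by field.
  by rewrite expRD; ring.
rewrite [leRHS](_ : _ = 2 * (2 ^ k)%:R^-1 * (n.+1%:R * n.+2%:R)^-1 *
    (expR (1 / 2) * (2 ^ q)%:R^-1)); last by ring.
by rewrite ler_wpM2l ?expR_Nsqr_half_le// !mulr_ge0 ?invr_ge0 ?mulr_ge0.
Qed.

(** A nonnegative series with finite expected sum is almost surely finite, hence has bounded terms.
    The triple series is summed over growing cubes of indices. *)
Lemma ae_weighted_deviation_bounded :
  {ae P, forall w, exists C, forall k n q, weighted_deviation (W ^~ w) k n q <= C}.
Proof.
pose H k n q w := weighted_deviation (W ^~ w) k n q.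
pose G N w := \sum_(k < N) \sum_(n < N) \sum_(q < N) H k n q w.
have H0 k n q w : 0 <= H k n q w by exact: weighted_deviation_ge0.
have H1 k n N w : 0 <= \sum_(q < N) H k n q w by exact: sumr_ge0.
have H2 k M N w : 0 <= \sum_(n < M) \sum_(q < N) H k n q w by exact: sumr_ge0.
have mH k n q : measurable_fun setT (H k n q) by exact: measurable_weighted_deviation.
have mH1 k n N : measurable_fun setT (fun w => \sum_(q < N) H k n q w).
  exact: measurable_sum.
have mH2 k M N : measurable_fun setT (fun w => \sum_(n < M) \sum_(q < N) H k n q w).
  exact: measurable_sum.
have : {ae P, forall w, exists C, forall N, G N w <= C}.
  (* After [2 * expR (1 / 2)], the factors 2, 1 and 2 bound the sums over [k], [n] and [q]. *)
  apply: (@nondecreasing_ae_bounded _ _ _ P G (2 * expR (1 / 2) * 2 * 1 * 2)).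
  - by move=> N; exact: measurable_sum.
  - by move=> N w; exact: sumr_ge0.
  - move=> w M N MN.
    apply: (ler_sum_ord (a := fun k => \sum_(n < M) \sum_(q < M) H k n q w)
      (b := fun k => \sum_(n < N) \sum_(q < N) H k n q w)) => // k.
    apply: (ler_sum_ord (a := fun n => \sum_(q < M) H k n q w)
      (b := fun n => \sum_(q < N) H k n q w)) => // n.
    exact: (ler_sum_ord (a := fun q => H k n q w) (b := fun q => H k n q w)).
  - move=> N; rewrite (@integral_sum_ord _ _ _ P N (fun k w =>
      \sum_(n < N) \sum_(q < N) H k n q w))//.
    apply: le_trans (_ : ((\sum_(k < N) \sum_(n < N) \sum_(q < N) (2 * expR (1 / 2) *
        (2 ^ k)%:R^-1 * (n.+1%:R * n.+2%:R)^-1 * (2 ^ q)%:R^-1))%:E <= _)%E).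
      rewrite -sumEFin; apply: lee_sum => k _.
      rewrite (@integral_sum_ord _ _ _ P N (fun n w => \sum_(q < N) H k n q w))//.
      rewrite -sumEFin; apply: lee_sum => n _.
      rewrite (@integral_sum_ord _ _ _ P N (fun q w => H k n q w))//.
      by rewrite -sumEFin; apply: lee_sum => q _; exact: integral_weighted_deviation.
    rewrite lee_fin.
    under eq_bigr => k _ do (under eq_bigr => n _ do rewrite -mulr_sumr;
      rewrite -mulr_suml -mulr_sumr).
    rewrite -mulr_suml -mulr_suml -mulr_sumr.
    have e0 : 0 <= 2 * expR (1 / 2) :> R by rewrite mulr_ge0 ?expR_ge0.
    have s1 : 0 <= \sum_(k < N) (2 ^ k)%:R^-1 :> R by apply: sumr_ge0 => *; rewrite invr_ge0.
    have s2 : 0 <= \sum_(n < N) (n.+1%:R * n.+2%:R)^-1 :> R.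
      by apply: sumr_ge0 => *; rewrite invr_ge0 mulr_ge0.
    do 2! (apply: ler_pM; rewrite ?sum_pow2_le ?sum_inv_rising_le// ?mulr_ge0//).
    by rewrite ler_wpM2l// sum_pow2_le.
apply: filterS => w [C GC]; exists C => k n q.
pose N := (maxn k (maxn n q)).+1.
have kN : (k < N)%N by rewrite /N; lia.
have nN : (n < N)%N by rewrite /N; lia.
have qN : (q < N)%N by rewrite /N; lia.
apply: le_trans (GC N).
apply: le_trans (term_le_sum_ord (a := fun k => \sum_(n < N) \sum_(q < N) H k n q w) kN _) => //.
apply: le_trans (term_le_sum_ord (a := fun n => \sum_(q < N) H k n q w) nN _) => //.
by apply: le_trans (term_le_sum_ord (a := fun q => H k n q w) qN _).
Qed.

(** The weight inverts to a bound on the squared deviation; its root, at most [C + 1] times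
    [n.+2%:R * e], is added to the mean [expR (th ^+ 2 / 8)], which accounts for the last unit in
    [C + 2]. *)
Lemma empirical_mgf_le (f : R -> R) (C th : R) k n (q : nat) : 0 <= C ->
  th ^+ 2 = q%:R ^+ 2 ->
  (n.+1%:R * n.+2%:R)^-1 * expR (- q%:R ^+ 2) * deviation f k n th ^+ 2 <= C ->
  empirical_mgf f k n th <= (C + 2) * n.+2%:R * expR (q%:R ^+ 2 / 2).
Proof.
move=> C0 thq devC; set e := expR (q%:R ^+ 2 / 2); set D := deviation _ _ _ _ in devC.
have e0 : 0 < e by exact: expR_gt0.
have n0 : 1 <= n.+2%:R :> R by rewrite ler1n.
have DC : D ^+ 2 <= ((C + 1) * (n.+2%:R * e)) ^+ 2.
  have e2 : e ^+ 2 = expR (q%:R ^+ 2) by rewrite /e -expRM_natl; congr expR; field.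
  have -> : D ^+ 2 = (n.+1%:R * n.+2%:R)^-1 * expR (- q%:R ^+ 2) * D ^+ 2 *
      (n.+1%:R * n.+2%:R * e ^+ 2).
    rewrite e2 expRN; field.
    by rewrite gt_eqF ?expR_gt0// -[1]/(1%:R) -!natrD !pnatr_eq0.
  apply: le_trans (_ : C * (n.+1%:R * n.+2%:R * e ^+ 2) <= _).
    by rewrite ler_wpM2r// !mulr_ge0 ?exprn_ge0 ?ltW.
  have e20 : 0 <= e ^+ 2 by rewrite exprn_ge0// ltW.
  (* Using [C + 1] in place of the square root of [C] keeps the bound polynomial. *)
  have CC : C <= (C + 1) ^+ 2 by nra.
  rewrite !exprMn; apply: ler_pM => //; first by apply: mulr_ge0 => //; apply: mulr_ge0.
  by rewrite ler_wpM2r// expr2 ler_wpM2r// ler_nat.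
have De : D <= (C + 1) * (n.+2%:R * e).
  have [D0|D0] := leP D 0; first by rewrite (le_trans D0)// !mulr_ge0 ?addr_ge0// ltW.
  by rewrite -(@ler_pXn2r _ 2)// nnegrE ?(ltW D0)// !mulr_ge0 ?addr_ge0// ltW.
have -> : empirical_mgf f k n th = D + expR (th ^+ 2 / 8) by rewrite /D /deviation subrK.
have ee : expR (th ^+ 2 / 8) <= n.+2%:R * e.
  apply: le_trans (_ : e <= _); last by rewrite ler_peMl// ltW.
  by rewrite ler_expR thq ler_wpM2l ?sqr_ge0// lef_pV2 ?posrE// ler_nat.
by apply: le_trans (lerD De ee) _; rewrite le_eqVlt; apply/orP; left; apply/eqP; ring.
Qed.

Lemma ae_empirical_mgf_bounded :
  {ae P, forall w, exists2 C, 1 <= C & forall k n (q : nat),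
    empirical_mgf (W ^~ w) k n q%:R <= C * n.+2%:R * expR (q%:R ^+ 2 / 2) /\
    empirical_mgf (W ^~ w) k n (- q%:R) <= C * n.+2%:R * expR (q%:R ^+ 2 / 2)}.
Proof.
apply: filterS ae_weighted_deviation_bounded => w [C devC].
have C0 : 0 <= C by apply: le_trans (devC 0%N 0%N 0%N); exact: weighted_deviation_ge0.
exists (C + 2) => [|k n q]; first by rewrite -lerBlDr; apply: le_trans C0; lra.
have c0 : 0 <= (n.+1%:R * n.+2%:R)^-1 * expR (- q%:R ^+ 2) :> R.
  by rewrite mulr_ge0 ?expR_ge0// invr_ge0 mulr_ge0.
split; apply: empirical_mgf_le => //; rewrite ?sqrrN//;
  apply: le_trans (devC k n q); rewrite /weighted_deviation ler_wpM2l//.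
- by rewrite lerDl sqr_ge0.
- by rewrite lerDr sqr_ge0.
Qed.
End almost_sure.

(** * Level sets and the deterministic estimate *)

Section dyadic_averages.
Context {R : realType}.
Notation mu := (@lebesgue_measure R).

Lemma measurable_dyI (j m : nat) : measurable (dyI j m : set R).
Proof. exact: measurable_itv. Qed.

Lemma lebesgue_measure_dyI (j m : nat) : mu (dyI j m) = (2 ^- j)%:E.
Proof.
rewrite /dyI lebesgue_measure_itv/= lte_fin ltr_pM2r ?invr_gt0 ?exprn_gt0// ltr_nat ltnSn.
by rewrite -EFinB -mulrBl -natrB// subSnn mul1r.
Qed.

(** The intervals are closed and neighbours share an endpoint; locating it as a left endpoint makes
    overlaps negligible for measure. *)
Lemma dyI_overlap (j l m : nat) (x : R) :
  (l < m)%N -> dyI j l x -> dyI j m x -> x = m%:R * 2 ^- j.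
Proof.
rewrite /dyI /= !in_itv/= => lm /andP[_ xl] /andP[xm _].
apply/eqP; rewrite eq_le xm andbT (le_trans xl)// ler_wpM2r ?invr_ge0 ?exprn_ge0//.
by rewrite ler_nat.
Qed.

Lemma dyI_refine (k n m : nat) : dyI (k + n) m `<=` (dyI k (m %/ 2 ^ n) : set R).
Proof.
have scale (i : nat) : i%:R * 2 ^- k = (i * 2 ^ n)%:R * 2 ^- (k + n) :> R.
  by rewrite natrM natrX exprD; field; rewrite !expf_neq0.
move=> x; rewrite /dyI /= !in_itv/= => /andP[mx xm]; rewrite !scale.
apply/andP; split.
  by apply: le_trans mx; rewrite ler_wpM2r ?invr_ge0 ?exprn_ge0// ler_nat leq_trunc_div.
apply: le_trans xm _; rewrite ler_wpM2r ?invr_ge0 ?exprn_ge0// ler_nat.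
by rewrite ltn_ceil// expn_gt0.
Qed.

Lemma measure_dyI_inter (k n l m : nat) :
  mu (dyI (k + n) m `&` dyI k l) = ((m %/ 2 ^ n == l)%N%:R * 2 ^- (k + n))%:E.
Proof.
case: eqVneq => [<-|ml].
  by rewrite setIidl ?mul1r ?lebesgue_measure_dyI//; exact: dyI_refine.
rewrite mul0r; apply/eqP; rewrite eq_le measure_ge0 andbT.
(* With distinct ancestors the intersection lies in the single point where the right-hand interval
   of level [k] begins. *)
pose p := maxn (m %/ 2 ^ n) l.
rewrite -[0%:E]/0%E -(lebesgue_measure_set1 (p%:R * 2 ^- k)) le_measure ?inE//.
  by apply: measurableI; exact: measurable_dyI.
move=> x [/dyI_refine xm xl] /=; rewrite /p.
have [mltl|lltm|/eqP] := ltngtP (m %/ 2 ^ n)%N l.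
- exact: dyI_overlap xm xl.
- exact: dyI_overlap xl xm.
- by rewrite (negbTE ml).
Qed.

(** Up to null sets, the intervals of level [k + n] inside the [l]-th one of level [k] are those of
    index [m] with [m %/ 2 ^ n = l]; the factors [2 ^+ k] and [2 ^- (k + n)] leave [2 ^- n]. *)
Lemma dyadic_mean_faber_level (f : R -> R) (k n l : nat) : (l < 2 ^ k)%N ->
  2 ^+ k * (\int[mu]_(t in dyI k l) faber_level f (k + n) t) = block_avg f k n l.
Proof.
move=> lk.
have indI m : mu.-integrable (dyI k l) (EFin \o \1_(dyI (k + n) m)).
  apply: (integrableS measurableT) => //; first exact: measurable_dyI.
  exact: integrable_indic_itv.
have -> : \int[mu]_(t in dyI k l) faber_level f (k + n) t =
    \sum_(m < 2 ^ (k + n)) faber_coef f (k + n) m *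
      ((m %/ 2 ^ n == l)%N%:R * 2 ^- (k + n)).
  rewrite /Rintegral /faber_level; under eq_integral do rewrite -sumEFin.
  rewrite (@integral_sum _ _ _ mu _ (measurable_dyI k l) _
    (fun (m : 'I_(2 ^ (k + n))) t => (faber_coef f (k + n) m * \1_(dyI (k + n) m) t)%:E)).
    rewrite -[RHS]/(fine _%:E) -sumEFin; congr fine; apply: eq_bigr => m _.
    under eq_integral do rewrite EFinM.
    rewrite integralZl ?indI//; last exact: measurable_dyI.
    rewrite integral_indic; [|exact: measurable_dyI|exact: measurable_dyI].
    exact: (congr1 (fun x => (faber_coef f (k + n) m)%:E * x)%E (measure_dyI_inter k n l m)).
  move=> m; under eq_fun do rewrite EFinM.
  apply: integrableZl; [exact: measurable_dyI|exact: indI].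
have q0 : (0 < 2 ^ n)%N by rewrite expn_gt0.
transitivity (2 ^+ k * \sum_(l' < 2 ^ k) \sum_(i < 2 ^ n)
    faber_coef f (k + n) (l' * 2 ^ n + i) * ((nat_of_ord l' == l)%:R * 2 ^- (k + n))).
  rewrite -(sum_divn_modn (2 ^ k) (fun l' i =>
    faber_coef f (k + n) (l' * 2 ^ n + i) * ((l' == l)%:R * 2 ^- (k + n))) q0) -expnD.
  by congr (_ * _); apply: eq_bigr => m _; rewrite -divn_eq.
rewrite (bigD1 (Ordinal lk))//= eqxx [X in _ + X]big1 ?addr0; last first.
  move=> l' l'l; rewrite big1// => i _.
  by rewrite (_ : nat_of_ord l' == l = false) ?mul0r ?mulr0//; exact: negbTE.
rewrite mul1r -mulr_suml /block_avg exprD; field.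
by rewrite !expf_neq0.
Qed.

Lemma eq_avg_op (k : nat) (g : R -> R) (a : nat -> R) :
  (forall l, (l < 2 ^ k)%N -> 2 ^+ k * (\int[mu]_(t in dyI k l) g t) = a l) ->
  avg_op k g = fun x => \sum_(l < 2 ^ k) a l * \1_(dyI k l) x.
Proof. by move=> ga; apply/funext => x; apply: eq_bigr => l _; rewrite ga. Qed.

Lemma measure_level_set_step (k : nat) (a : nat -> R) (s : R) : 0 <= s ->
  (mu (level_set (fun x => \sum_(l < 2 ^ k) a l * \1_(dyI k l) x)%R s) <=
   (\sum_(l < 2 ^ k) (s < `|a l|)%R%:R * (2 ^ k)%:R^-1)%:E)%E.
Proof.
move=> s0; set h := fun x => _.
have mh : measurable_fun setT h.
  apply: measurable_sum => l; apply: measurable_funM => //.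
  by apply: measurable_indic; exact: measurable_dyI.
(* Off the left endpoints [l 2^-k] at most one of the closed intervals contains a given point. *)
pose B l : set R := if s < `|a l| then dyI k l else [set l%:R * 2 ^- k].
have mB l : measurable (B l).
  by rewrite /B; case: ifP => _; [exact: measurable_dyI|exact: measurable_set1].
have lB l : mu (B l) = ((s < `|a l|)%R%:R * (2 ^ k)%:R^-1)%:E.
  rewrite /B; case: ifP => _; first by rewrite lebesgue_measure_dyI mul1r natrX.
  by rewrite lebesgue_measure_set1 mul0r.
have endB l : B l (l%:R * 2 ^- k).
  rewrite /B; case: ifP => //= _.
  by rewrite /dyI /= in_itv/= lexx/= ler_wpM2r ?invr_ge0 ?exprn_ge0// ler_nat.
rewrite -sumEFin; under eq_bigr do rewrite -lB.
apply: (content_subadditive mu); first by move=> l _; exact: mB.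
  apply: measurableI; first exact: measurable_itv.
  rewrite (_ : [set _ | _] = (Num.norm \o h) @^-1` `]s, +oo[); last first.
    by apply/seteqP; split => y /=; rewrite in_itv/= andbT.
  rewrite -[X in measurable X]setTI.
  by apply: (measurableT_comp _ mh) => //; exact: measurable_itv.
move=> x [_ /= shx]; rewrite -bigcup_mkord.
(* A point outside every [B l] is no left endpoint, so it lies in at most one interval, and the
   coefficient there is at most [s] in modulus. *)
case: (pselect (exists2 l, (l < 2 ^ k)%N & B l x)) => [[l lk Blx]|noB]; first by exists l.
exfalso; move: shx; apply/negP; rewrite -leNgt.
have nd l : (l < 2 ^ k)%N -> x <> l%:R * 2 ^- k.
  by move=> lk xl; apply: noB; exists l => //; rewrite xl.
have al l : (l < 2 ^ k)%N -> dyI k l x -> `|a l| <= s.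
  move=> lk xl; rewrite leNgt; apply/negP => sal.
  by apply: noB; exists l => //; rewrite /B sal.
case: (pselect (exists l : 'I_(2 ^ k), dyI k l x)) => [[l xl]|nox].
  rewrite /h (bigD1 l)//= big1 ?addr0.
    by rewrite indicE mem_set// mulr1 al.
  move=> m ml; rewrite indicE memNset ?mulr0// => xm.
  have [mltl|lltm|/val_inj/eqP] := ltngtP m l.
  - exact: (nd l (ltn_ord l) (dyI_overlap mltl xm xl)).
  - exact: (nd m (ltn_ord m) (dyI_overlap lltm xl xm)).
  - by rewrite (negbTE ml).
rewrite /h big1 ?normr0// => l _.
by rewrite indicE memNset ?mulr0// => xl; apply: nox; exists l.
Qed.

Lemma measure_level_set_avg (f : R -> R) (k n : nat) (u : R) : 0 <= u ->
  (mu (level_set (avg_op k (faber_level f (k + n))) (u / 2 `^ (n%:R / 2))) <=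
   (\sum_(l < 2 ^ k) (u < `|normalized_block f k n l|)%R%:R * (2 ^ k)%:R^-1)%:E)%E.
Proof.
move=> u0; rewrite (eq_avg_op (a := block_avg f k n)); last first.
  by move=> l; exact: dyadic_mean_faber_level.
have p0 : 0 < 2 `^ (n%:R / 2) :> R by rewrite powR_gt0.
apply: le_trans (measure_level_set_step _ _ _) _; first by rewrite divr_ge0// ltW.
rewrite le_eqVlt; apply/orP; left; apply/eqP; congr EFin; apply: eq_bigr => l _.
by rewrite ltr_pdivrMr// /normalized_block [in RHS]normrM (gtr0_norm p0)
  [`|_| * _]mulrC.
Qed.

(* Exponential Chebyshev inequality at the integer parameter [q = floor u], where
   [q^2/2 - q u] is within [1/2] of its minimum [- u^2/2]. *)
Lemma block_tail_le (f : R -> R) (k n : nat) (C u : R) : 0 <= u ->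
  (forall q : nat,
    empirical_mgf f k n q%:R <= C * n.+2%:R * expR (q%:R ^+ 2 / 2) /\
    empirical_mgf f k n (- q%:R) <= C * n.+2%:R * expR (q%:R ^+ 2 / 2)) ->
  \sum_(l < 2 ^ k) (u < `|normalized_block f k n l|)%R%:R * (2 ^ k)%:R^-1 <=
    2 * C * n.+2%:R * expR (1 / 2 - u ^+ 2 / 2).
Proof.
move=> u0 empC; pose q := Num.truncn u.
have /andP[qu uq] := truncn_itv u0; have [emp1 emp2] := empC q.
(* The indicator of [u < |Y|] is at most [expR (- q u) (expR (q Y) + expR (- q Y))]. *)
apply: le_trans (_ : expR (- (q%:R * u)) *
    (empirical_mgf f k n q%:R + empirical_mgf f k n (- q%:R)) <= _).
  rewrite /empirical_mgf -mulrDr -big_split/= mulrCA -[leLHS]mulr_suml [leLHS]mulrC.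
  rewrite ler_wpM2l ?invr_ge0// mulr_sumr; apply: ler_sum => l _.
  set Y := normalized_block f k n l.
  have e1 := expR_ge0 (q%:R * Y); have e2 := expR_ge0 (- q%:R * Y).
  case: ltP => [uY|_]; last by rewrite mulr_ge0 ?expR_ge0// addr_ge0.
  apply: le_trans (_ : expR (- (q%:R * u)) * expR (q%:R * `|Y|) <= _).
    by rewrite -expRD -expR0 ler_expR addrC subr_ge0 ler_wpM2l// ltW.
  rewrite ler_wpM2l ?expR_ge0//; have [Y0|Y0] := leP 0 Y.
    by rewrite ger0_norm// lerDl.
  by rewrite ltr0_norm// mulrN -mulNr lerDr.
apply: le_trans (ler_wpM2l (expR_ge0 _) (lerD emp1 emp2)) _.
rewrite -mulr2n -[_ *+ 2]mulr_natl [leLHS](_ : _ =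
  2 * C * n.+2%:R * (expR (- (q%:R * u)) * expR (q%:R ^+ 2 / 2))); last by ring.
(* The sign of [C] is read off from the bound itself, since an empirical exponential moment is
   nonnegative. *)
have Cn : 0 <= C * n.+2%:R.
  rewrite -(pmulr_lge0 _ (expR_gt0 (q%:R ^+ 2 / 2))); apply: le_trans emp1.
  by rewrite mulr_ge0 ?invr_ge0// sumr_ge0// => l _; exact: expR_ge0.
rewrite ler_wpM2l//; first by rewrite -mulrA mulr_ge0.
rewrite -expRD ler_expR -subr_ge0.
rewrite (_ : _ - _ = (1 - (u - q%:R)) * (1 + (u - q%:R)) / 2); last by field.
have uq1 : u - q%:R <= 1 by rewrite lerBlDl natr1 ltW.
have uq0 : 0 <= u - q%:R by rewrite subr_ge0.
by rewrite divr_ge0// mulr_ge0 ?subr_ge0// addr_ge0.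
Qed.

(** This is [ln y < y] at [y = x^(2 eps)]; it lets the power of [n + 1] in the norm pay for the
    factor [n + 2] in the tail bound. *)
Lemma ln_le_powR_sqr (eps x : R) : 0 < eps -> 1 <= x ->
  ln x <= (2 * eps)^-1 * (x `^ eps) ^+ 2.
Proof.
move=> eps0 x1.
have x0 : 0 < x by exact: lt_le_trans x1.
rewrite -ler_pdivrMl ?invr_gt0 ?mulr_gt0// invrK.
rewrite -[leLHS](_ : ln ((x `^ eps) ^+ 2) = _); last first.
  by rewrite lnXn ?powR_gt0// ln_powR -[LHS]mulr_natl mulrA.
by apply/ltW/ln_sublinear; rewrite exprn_gt0// powR_gt0.
Qed.

(** With [z = (n + 1)^(2 eps)] and [L = ln (1 / t) + 1], both at least 1, [u^2 / 2] is [z L] times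
    the three summands under the root in [K]. They absorb, in order, [ln (4 C)], [ln (n + 1)] and
    [ln (1 / t) + 1 / 2]. *)
Lemma tail_threshold (eps C t : R) (n : nat)
    (K := Num.sqrt (2 * (ln (4 * C) + (2 * eps)^-1 + 1)))
    (u := K * (n.+1%:R `^ eps) * Num.sqrt (ln t^-1 + 1)) :
  0 < eps -> 1 <= C -> 0 < t < 1 ->
  2 * C * n.+2%:R * expR (1 / 2 - u ^+ 2 / 2) <= t.
Proof.
move=> eps0 C1 /andP[t0 t1].
have C0 : 0 < C by exact: lt_le_trans C1.
set L := ln t^-1 + 1 in u *; set z := (n.+1%:R `^ eps) ^+ 2.
have L1 : 1 <= L by rewrite lerDr lnV ?posrE// oppr_ge0 ln_le0// ltW.
have z1 : 1 <= z.
  by rewrite exprn_ege1// -[leLHS](powRr0 n.+1%:R) ler_powR ?ler1n// ltW.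
have b0 : 0 <= ln (4 * C) by rewrite ln_ge0//; lra.
have e0 : 0 < (2 * eps)^-1 by rewrite invr_gt0 mulr_gt0.
have u2 : u ^+ 2 = 2 * (ln (4 * C) + (2 * eps)^-1 + 1) * z * L.
  by rewrite /u !exprMn !sqr_sqrtr//; [lra|rewrite mulr_ge0// addr_ge0 ?addr_ge0 ?(ltW e0)].
have lnn : ln n.+1%:R <= (2 * eps)^-1 * z by apply: ln_le_powR_sqr; rewrite ?ler1n.
have key : ln (4 * C) + ln n.+1%:R + (1 / 2 - u ^+ 2 / 2) <= - (ln t^-1).
  have zL : 1 <= z * L by rewrite mulr_ege1.
  have zLz : z <= z * L by rewrite ler_peMr// (le_trans _ z1).
  have zLL : L <= z * L by rewrite ler_peMl// (le_trans _ L1).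
  have : ln (4 * C) <= ln (4 * C) * (z * L) by rewrite ler_peMr.
  have : (2 * eps)^-1 * z <= (2 * eps)^-1 * (z * L) by rewrite ler_pM2l.
  rewrite u2; have -> : ln t^-1 = L - 1 by rewrite addrK.
  set b := ln (4 * C) in b0 *; set e := (2 * eps)^-1 in e0 lnn *.
  have -> : 2 * (b + e + 1) * z * L / 2 = b * (z * L) + e * (z * L) + z * L by field.
  by move: lnn zLL; lra.
apply: le_trans (_ : expR (ln (4 * C) + ln n.+1%:R + (1 / 2 - u ^+ 2 / 2)) <= _).
  rewrite !expRD !lnK ?posrE ?mulr_gt0// -expRD ler_wpM2r ?expR_ge0//.
  (* Here [n + 2 <= 2 (n + 1)], whence the 4 in [ln (4 * C)]. *)
  rewrite -[n.+2%:R]natr1 -[n.+1%:R]natr1; have : 0 <= n%:R :> R by []; nra.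
rewrite -[leRHS](@lnK _ t) ?posrE// ler_expR (le_trans key)//.
by rewrite lnV ?posrE// opprK.
Qed.
End dyadic_averages.

(** The level [u / 2 ^ (n / 2)] is admissible in the infimum defining the rearrangement, and the
    weight of the norm turns it into exactly [K], which is free of [j], [k] and [t]. *)
Lemma A_norm_lt_pinfty (R : realType) (eps C : R) (f : R -> R) :
  0 < eps -> 1 <= C ->
  (forall k n (q : nat),
    empirical_mgf f k n q%:R <= C * n.+2%:R * expR (q%:R ^+ 2 / 2) /\
    empirical_mgf f k n (- q%:R) <= C * n.+2%:R * expR (q%:R ^+ 2 / 2)) ->
  (A_norm eps f < +oo)%E.
Proof.
move=> eps0 C1 empC.
pose K : R := Num.sqrt (2 * (ln (4 * C) + (2 * eps)^-1 + 1)).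
apply: (@le_lt_trans _ _ K%:E); last exact: ltry.
apply: ge_ereal_sup => _ [j [k [t [kj [t01 ->]]]]].
rewrite addn1; set n := (j - k)%N.
have -> : j = (k + n)%N by rewrite /n subnKC.
have /andP[t0 t1] := t01.
have L0 : 0 < ln t^-1 + 1 by rewrite ltr_wpDl// lnV ?posrE// oppr_ge0 ln_le0// ltW.
have x0 : 0 < n.+1%:R `^ eps by rewrite powR_gt0.
have p0 : 0 < 2 `^ (n%:R / 2) :> R by rewrite powR_gt0.
have S0 : 0 < Num.sqrt (ln t^-1 + 1) by rewrite sqrtr_gt0.
pose u : R := K * (n.+1%:R `^ eps) * Num.sqrt (ln t^-1 + 1).
have u0 : 0 <= u by rewrite !mulr_ge0 ?sqrtr_ge0// ltW.
have rearr : (decr_rearr (avg_op k (faber_level f (k + n))) t <=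
    (u / 2 `^ (n%:R / 2))%:E)%E.
  apply: ereal_inf_lbound; exists (u / 2 `^ (n%:R / 2)) => //; split.
    by rewrite divr_ge0// ltW.
  apply: le_trans (measure_level_set_avg _ _ _ u0) _; rewrite lee_fin.
  exact: le_trans (block_tail_le u0 (empC k n)) (tail_threshold _ eps0 C1 t01).
apply: le_trans (lee_wpmul2l _ rearr) _.
  by rewrite lee_fin !divr_ge0 ?powR_ge0 ?sqrtr_ge0.
rewrite -EFinM lee_fin le_eqVlt; apply/orP; left; apply/eqP.
by rewrite /u; field; rewrite !gt_eqF.
Qed.

Theorem theorem2p8 (R : realType) (d : measure_display) (T : measurableType d)
  (P : probability T R) (W : R -> T -> R) (eps : R) :
  standard_wiener P W -> 0 < eps ->
  {ae P, forall w, (A_norm eps (fun t => W t w) < +oo)%E}.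
Proof.
move=> wienerW eps0.
apply: filterS (ae_empirical_mgf_bounded wienerW) => w [C C1 empC].
exact: A_norm_lt_pinfty eps0 C1 empC.
Qed.
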